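(* Let $\alpha\in(0,1)$ be irrational and suppose there are constants $A\ge1$, $p\ge0$ such that $a_n\le A\,n^p$ for all $n\ge1$. Then there are constants $C,\theta_1,\theta_2,\theta_3$ such that, for all real centered functions $\psi,\varphi$ of bounded variation on $\mathbb T^1$, all integers $1\le k\le m\le\ell$, and all integers $b_k,b_m,b_\ell$ with $0\le b_i\le a_{i+1}$ for $i\in\{k,m,\ell\}$: $$\Big|\int_X\psi\,\varphi_{b_kq_k}\,d\mu\Big|\le C\,V(\psi)V(\varphi)\,\frac{k^{\theta_1}}{q_k}\,b_k,$$ $$\Big|\int_X\psi\,\varphi_{b_kq_k}\varphi_{b_mq_m}\,d\mu\Big|\le C\,V(\psi)V(\varphi)^2\,\frac{m^{\theta_2}}{q_k}\,b_kb_m,$$ $$\Big|\int_X\psi\,\varphi_{b_kq_k}\varphi_{b_mq_m}\varphi_{b_\ell q_\ell}\,d\mu\Big|\le C\,V(\psi)V(\varphi)^3\,\frac{\ell^{\theta_3}}{q_k}\,b_kb_mb_\ell.$$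
   Context: $\alpha=[0;a_1,a_2,\dots]$ has partial quotients $a_n$ and denominators $q_n$: $q_0=1$, $q_1=a_1$, $q_{n+1}=a_{n+1}q_n+q_{n-1}$. $X=\mathbb T^1=\mathbb R/\mathbb Z$ with Lebesgue measure $\mu$; functions on $X$ are 1-periodic functions and $V(f)$ is the total variation of $f$ restricted to $[0,1]$; centered means $\int_X f\,d\mu=0$. $\varphi_n(x)=\sum_{j=0}^{n-1}\varphi(x+j\alpha)$, with $\varphi_0=0$. *)

(* Defs.v *)
From mathcomp Require Import all_boot all_order all_algebra.
From mathcomp Require Import all_classical all_reals all_analysis.

Set Implicit Arguments.
Unset Strict Implicit.
Unset Printing Implicit Defensive.

Import Order.TTheory GRing.Theory Num.Theory.
Local Open Scope ring_scope.

(* The Gauss map x |-> {1/x}; [truncn] is the integer part here, as it is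
   only used at points x > 0. *)
Definition gauss_map (R : realType) (x : R) : R :=
  x^-1 - (Num.truncn x^-1)%:R.

(* The n-th partial quotient of alpha = [0; a_1, a_2, ...], for alpha in
   (0, 1): a_(n+1) is the integer part of 1 / G^n(alpha), G the Gauss map. *)
Definition cf_quotient (R : realType) (alpha : R) (n : nat) : nat :=
  if n is n1.+1 then Num.truncn (iter n1 (@gauss_map R) alpha)^-1 else 0%N.

Fixpoint cf_denom (R : realType) (alpha : R) (n : nat) : nat :=
  if n is n1.+1 then
    if n1 is n2.+1 then
      (cf_quotient alpha n * cf_denom alpha n1 + cf_denom alpha n2)%N
    else cf_quotient alpha 1
  else 1%N.

Definition birkhoff_sum (R : realType) (alpha : R) (phi : R -> R) (n : nat)
    (x : R) : R :=
  \sum_(0 <= j < n) phi (x + j%:R * alpha).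

(* Functions on the circle R/Z are represented by 1-periodic functions on R,
   and the integral over the circle by the Lebesgue integral over [0, 1]. *)
Definition integral_circle (R : realType) (f : R -> R) : R :=
  \int[@lebesgue_measure R]_(x in `[0, 1]%classic) f x.

Definition centered_BV (R : realType) (f : R -> R) : Prop :=
  [/\ periodic f 1, bounded_variation 0 1 f & integral_circle f = 0].

(* Finite, hence unaffected by [fine], when f has bounded variation. *)
Definition circle_variation (R : realType) (f : R -> R) : R :=
  fine (total_variation 0 1 f).

(* Main.v *)
(* Let g be the product of the ergodic sums of phi.  As the rotation preserves
   the integral, q_k \int psi g is the integral over x of
   \sum_(j < q_k) psi(x + j alpha) g(x + j alpha).  Summation by parts bounds
   this sum, uniformly in x, by
     sup_(j <= q_k) |psi_j| * (sup |g| + variation of g along the orbit).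
   - By Denjoy-Koksma, |phi_(b q_m)| <= 6 b V(phi), and likewise for psi; the
     Ostrowski expansion of j then gives |psi_j| <= 6 V(psi) (a_1 + ... + a_k)
     = O(k^(p+1)) for j <= q_k.
   - For m >= k, phi_(q_m)(y + alpha) - phi_(q_m)(y) = phi(y + q_m alpha) - phi(y)
     and ||q_m alpha|| <= 1 / q_k, while the points x + j alpha, j < q_k, are
     1 / q_k-close to the distinct nodes of a regular grid of mesh 1 / q_k; so
     phi_(q_m) varies by at most 4 V(phi) along an orbit segment of length q_k.
   Both facts use only |q_n alpha - p_n| <= 1 / q_n and coprimality of p_n
   and q_n. *)
Require Import Defs.
From HB Require Import structures.
From mathcomp Require Import all_boot all_order all_algebra.
From mathcomp Require Import all_classical all_reals all_analysis.
From mathcomp Require Import ring lra zify.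

Set Implicit Arguments.
Unset Strict Implicit.
Unset Printing Implicit Defensive.

Import Order.TTheory GRing.Theory Num.Theory.
Local Open Scope classical_set_scope.
Local Open Scope ring_scope.

(** * Convergents of [alpha] and the quality of their approximation *)

Section ContinuedFraction.
Variables (R : realType) (alpha : R).
Hypotheses (alpha_gt0 : 0 < alpha) (alpha_lt1 : alpha < 1).
Hypothesis alpha_irr : irrational alpha.

Local Notation a := (cf_quotient alpha).
Local Notation q := (cf_denom alpha).
Local Notation x_ n := (iter n (@gauss_map R) alpha).

Fixpoint cf_numer (n : nat) : nat :=
  if n is n1.+1 then
    if n1 is n2.+1 then (a n * cf_numer n1 + cf_numer n2)%N else 1%N
  else 0%N.

Local Notation p := cf_numer.

Lemma cf_denomSS n : q n.+2 = (a n.+2 * q n.+1 + q n)%N.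
Proof. by []. Qed.

Lemma cf_numerSS n : p n.+2 = (a n.+2 * p n.+1 + p n)%N.
Proof. by []. Qed.

Lemma gauss_map_itv (x : R) : 0 < x -> 0 <= gauss_map x < 1.
Proof.
move=> x0; have : 0 <= x^-1 by rewrite invr_ge0 ltW.
by move=> /truncn_itv; rewrite /gauss_map -natr1 subr_ge0 ltrBlDl addrC.
Qed.

Lemma irrational_ratio (m n : nat) : alpha * n%:R = m%:R -> n = 0%N.
Proof.
move=> e; apply: contrapT => /eqP n0; apply: alpha_irr.
exists (m%:R / n%:R) => //; rewrite fmorph_div /= !ratr_nat -e mulfK//.
by rewrite pnatr_eq0.
Qed.

(** The identity is [alpha = (p n.+1 + x_ n.+1 * p n) / (q n.+1 + x_ n.+1 * q n)] cleared of
    denominators. It is proved together with positivity: if the Gauss orbit reached 0 at step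
    [n.+1], the identity would give [alpha * q n.+1 = p n.+1], against irrationality. *)
Lemma complete_quotient n : 0 < x_ n < 1 /\ (0 < q n)%N /\
  alpha * ((q n.+1)%:R + x_ n.+1 * (q n)%:R) = (p n.+1)%:R + x_ n.+1 * (p n)%:R.
Proof.
have a_gt0 m : 0 < x_ m < 1 -> (0 < a m.+1)%N.
  by move=> /andP[? ?]; rewrite /= truncn_gt0 invf_ge1// ltW.
have x_gt0 m : 0 < x_ m < 1 -> (0 < q m.+1)%N ->
    alpha * ((q m.+1)%:R + x_ m.+1 * (q m)%:R)
      = (p m.+1)%:R + x_ m.+1 * (p m)%:R -> 0 < x_ m.+1 < 1.
  move=> /andP[x0 _] q0 e; have /andP[y0 y1] := gauss_map_itv x0.
  rewrite iterS y1 andbT lt_neqAle y0 andbT; apply/eqP => y00.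
  move: e; rewrite iterS -y00 !mul0r !addr0 => /irrational_ratio q00.
  by rewrite q00 in q0.
suff : [/\ 0 < x_ n < 1, (0 < q n)%N, (0 < q n.+1)%N &
    alpha * ((q n.+1)%:R + x_ n.+1 * (q n)%:R) = (p n.+1)%:R + x_ n.+1 * (p n)%:R].
  by case.
elim: n => [|n [xn qn qn1 e]].
  split => //; first by rewrite /= alpha_gt0.
    by apply: (a_gt0 0%N); rewrite /= alpha_gt0.
  rewrite /= /gauss_map mulr1 mulr0 addr0 addrC subrK divff//.
  by rewrite gt_eqF.
have xn1 := x_gt0 _ xn qn1 e.
have an2 := a_gt0 _ xn1.
split=> //; first by rewrite cf_denomSS addn_gt0 muln_gt0 an2 qn1.
have x1_neq0 : x_ n.+1 != 0 by rewrite gt_eqF//; case/andP: xn1.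
have eG : x_ n.+2 = (x_ n.+1)^-1 - (a n.+2)%:R by [].
rewrite eG cf_denomSS cf_numerSS; move: (x_ n.+1) x1_neq0 e => y y0 e.
(* Multiplying by [y = x_ n.+1] reduces the new identity to the previous one, because
   [y * x_ n.+2 = 1 - a n.+2 * y]. *)
apply: (mulfI y0); rewrite !natrD !natrM.
have -> : y * (alpha * ((a n.+2)%:R * (q n.+1)%:R + (q n)%:R
    + (y^-1 - (a n.+2)%:R) * (q n.+1)%:R))
    = alpha * ((q n.+1)%:R + y * (q n)%:R) by field.
by rewrite e; field.
Qed.

Lemma cf_denom_gt0 n : (0 < q n)%N.
Proof. by have [_ []] := complete_quotient n. Qed.

Lemma cf_quotient_gt0 n : (0 < a n.+1)%N.
Proof.
have [/andP[? ?] _] := complete_quotient n.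
by rewrite /= truncn_gt0 invf_ge1// ltW.
Qed.

Lemma cf_denom_nondecreasing : {homo q : m n / (m <= n)%N}.
Proof.
apply: homo_leq => [//|? ? ?|[|n]]; first exact: leq_trans.
  exact: cf_quotient_gt0.
by rewrite cf_denomSS -[leqLHS]mul1n (leq_trans _ (leq_addr _ _))// leq_mul2r
  cf_quotient_gt0 orbT.
Qed.

Lemma cf_det n :
  (p n.+1)%:Z * (q n)%:Z - (p n)%:Z * (q n.+1)%:Z = (-1) ^+ n.
Proof.
elim: n => [|n IH]; first by rewrite /= mul1r mul0r subr0.
rewrite cf_denomSS cf_numerSS !PoszD !PoszM exprS -IH; ring.
Qed.

(** A common divisor divides the determinant of [cf_det], which is a sign. *)
Lemma coprime_cf n : coprime (p n) (q n).
Proof.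
have dvd1 (d : nat) : (d %| p n)%N -> (d %| q n)%N -> (d %| 1)%N.
  move=> dp dq.
  have : (d%:Z %| ((-1) ^+ n : int))%Z.
    rewrite -cf_det; apply: rpredB; [apply: dvdz_mull|apply: dvdz_mulr]; exact.
  by rewrite dvdzE abszX exp1n.
by rewrite /coprime -dvdn1 dvd1 ?dvdn_gcdl ?dvdn_gcdr.
Qed.

(** At index [n.+1], [complete_quotient] and the determinant give the error exactly: up to sign it
    is [y / (q n.+1 + y * q n)] with [0 < y < 1]. At index 0 the claim is [alpha <= 1]. *)
Lemma convergent_dist n : `|(q n)%:R * alpha - (p n)%:R| <= (q n)%:R^-1.
Proof.
case: n => [|n].
  by rewrite /= mul1r subr0 invr1 gtr0_norm// ltW.
have [_ [_ e]] := complete_quotient n.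
have [/andP[y0 y1] _] := complete_quotient n.+1.
move: (x_ n.+1) y0 y1 e => y y0 y1 e.
have q0 : 0 < (q n.+1)%:R :> R by rewrite ltr0n cf_denom_gt0.
have q'0 : 0 <= (q n)%:R :> R by [].
have D0 : 0 < (q n.+1)%:R + y * (q n)%:R by rewrite ltr_pwDl// mulr_ge0// ltW.
have det : (p n.+1)%:R * (q n)%:R - (p n)%:R * (q n.+1)%:R = (-1) ^+ n :> R.
  have /(congr1 (fun z : int => z%:~R : R)) := cf_det n.
  by rewrite rmorphB !rmorphM rmorphXn rmorphN.
have -> : (q n.+1)%:R * alpha - (p n.+1)%:R =
    - ((-1) ^+ n * (y / ((q n.+1)%:R + y * (q n)%:R))).
  apply: (mulfI (lt0r_neq0 D0)); rewrite -det mulrBr mulrCA [_ * alpha]mulrC e.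
  by field; exact: lt0r_neq0.
rewrite normrN normrM normrX normrN1 expr1n mul1r gtr0_norm ?divr_gt0//.
rewrite ler_pdivrMr// mulrC ler_pdivlMr//.
have : y * (q n.+1)%:R <= 1 * (q n.+1)%:R by rewrite ler_wpM2r// ltW.
by rewrite mul1r => /le_trans; apply; rewrite lerDl mulr_ge0// ltW.
Qed.

End ContinuedFraction.

(** * Integration over the circle and its invariance under rotation *)

Section CircleIntegral.
Variable R : realType.
Implicit Types (f g : R -> R) (B t u v : R).
Local Notation mu := (@lebesgue_measure R).

Lemma measurable_translation t :
  measurable_fun [set: measurableTypeR R]
    ((fun x : R => x + t) : measurableTypeR R -> measurableTypeR R).
Proof. exact: measurable_realfun.measurable_funD. Qed.

(** The pushforward of Lebesgue measure by a translation agrees with it on half-open intervals,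
    which determines the measure. *)
Lemma lebesgue_measure_translation t (A : set R) : measurable A ->
  mu ((fun x => x + t) @^-1` A) = mu A.
Proof.
move=> mA; have := measurable_translation t => mt.
pose mf : {mfun measurableTypeR R >-> measurableTypeR R} :=
  HB.pack (fun x : measurableTypeR R => (x + t : measurableTypeR R))
    (isMeasurableFun.Build _ _ _ _ _ mt).
apply/esym; apply: (@lebesgue_measure_unique _ (pushforward mu mf)) => //.
move=> _ [[a b] _ <-] /=; rewrite /pushforward.
have -> : mf @^-1` `]a, b]%classic = `]a - t, b - t]%classic.
  by apply/seteqP; split => x /=; rewrite !in_itv /= ltrBlDr lerBrDr.
rewrite !lebesgue_measure_itv /= !lte_fin ltrBlDr subrK.
by case: ifP => // _; rewrite -!EFinB; congr (_%:E); ring.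
Qed.

Lemma integrable_bounded f B u v : measurable_fun [set: R] f ->
  (forall x, `|f x| <= B) -> mu.-integrable `[u, v]%classic (EFin \o f).
Proof.
move=> mf fB; apply: measurable_bounded_integrable => //.
- by rewrite /= lebesgue_measure_itv /=; case: ifP => // _; rewrite -EFinB ltry.
- exact: measurable_funTS.
- exists B; split; first by rewrite num_real.
  by move=> M BM x _; exact: le_trans (fB x) (ltW BM).
Qed.

Lemma Rintegral_translation f B t u v : measurable_fun [set: R] f ->
  (forall x, `|f x| <= B) ->
  \int[mu]_(x in `[u, v]) f (x + t) = \int[mu]_(x in `[u + t, v + t]) f x.
Proof.
move=> mf fB; rewrite /Rintegral; congr fine.
have preimE : (fun x => x + t) @^-1` `[u + t, v + t]%classic = `[u, v]%classic.
  by apply/seteqP; split => x /=; rewrite !in_itv /= !lerD2r.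
rewrite -[in LHS]preimE.
have := @integral_pushforward _ _ _ _ R _ (measurable_translation t) mu
  `[u + t, v + t]%classic (EFin \o f).
rewrite preimE => <- //.
- apply: eq_measure_integral => [|mt A mA _]; first exact: measurable_translation.
  exact: lebesgue_measure_translation.
- exact/measurable_realfun.measurable_EFinP.
- apply: (@integrable_bounded (fun x => f (x + t)) B) => //.
  exact: (measurableT_comp mf (measurable_translation t)).
Qed.

Lemma periodic_intr f : periodic f 1 -> forall (z : int) x, f (x + z%:~R) = f x.
Proof.
move=> f1 [n|n] x; first exact: (periodicn f1).
by rewrite NegzE mulrNz -[LHS](periodicn f1 n.+1) subrK.
Qed.

(** Periodicity reduces to [0 <= t <= 1]. The integral over [[0, 1 + t]] is then split at [t] and at
    1: the pieces over [[0, t]] and [[1, 1 + t]] agree by periodicity, hence so do those over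
    [[t, 1 + t]] and [[0, 1]]. *)
Lemma integral_circle_translation f B t : measurable_fun [set: R] f ->
  (forall x, `|f x| <= B) -> periodic f 1 ->
  integral_circle (fun x => f (x + t)) = integral_circle f.
Proof.
move=> mf fB f1.
wlog /andP[t0 t1] : t / 0 <= t <= 1.
  move=> hw; rewrite -(hw (t - (Num.floor t)%:~R)); last first.
    have /andP[h1 h2] := floor_itv t.
    rewrite subr_ge0 h1 /= lerBlDr addrC -[X in _ + X]/(1%:~R) -intrD ltW //.
  congr integral_circle; apply/funext => x.
  by rewrite -[RHS](periodic_intr f1 (Num.floor t)) addrA subrK.
have intf u v := integrable_bounded u v mf fB.
rewrite /integral_circle (Rintegral_translation _ _ _ mf fB) add0r.
have splitI v : 0 <= v -> v <= 1 + t -> \int[mu]_(x in `[0, 1 + t]) f x =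
    \int[mu]_(x in `[0, v]) f x + \int[mu]_(x in `[v, 1 + t]) f x.
  move=> v0 vt; rewrite -Rintegral_itv_obnd_cbnd.
    by rewrite -(Rintegral_itvB (intf 0 (1 + t)) (x := v)) ?bnd_simp// subrKC.
  by apply: integrableS (intf v (1 + t)) => //; exact: subset_itv_oc_cc.
have := splitI t t0; rewrite lerDr ler01 => /(_ isT).
have := splitI 1 ler01; rewrite lerDl t0 => /(_ isT) ->.
suff -> : \int[mu]_(x in `[1, 1 + t]) f x = \int[mu]_(x in `[0, t]) f x.
  by rewrite addrC => /addrI.
rewrite -[X in `[X, _]]add0r [1 + t]addrC -(Rintegral_translation _ _ _ mf fB).
by apply: eq_Rintegral => x _; exact: f1.
Qed.

Lemma integral_circle_cst (c : R) : integral_circle (fun=> c) = c.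
Proof.
by rewrite /integral_circle Rintegral_cst//= lebesgue_measure_itv /= lte01
  /= subr0 mulr1.
Qed.

Lemma integral_circleD f g B (C : R) : measurable_fun [set: R] f ->
  measurable_fun [set: R] g -> (forall x, `|f x| <= B) ->
  (forall x, `|g x| <= C) ->
  integral_circle (fun x => f x + g x) = integral_circle f + integral_circle g.
Proof.
move=> mf mg fB gC; apply: RintegralD => //.
- exact: integrable_bounded fB.
- exact: integrable_bounded gC.
Qed.

Lemma le_norm_integral_circle f B : measurable_fun [set: R] f ->
  (forall x, `|f x| <= B) -> `|integral_circle f| <= B.
Proof.
move=> mf fB; have intf := integrable_bounded 0 1 mf fB.
apply: le_trans (le_normr_Rintegral _ intf) _ => //.
rewrite -[leRHS](integral_circle_cst B); apply: le_Rintegral => //.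
  exact: (integrable_norm intf).
apply: (@integrable_bounded (fun=> B) `|B|) => //.
Qed.

Lemma integral_circle_sum (F : nat -> R -> R) B n :
  (forall j, measurable_fun [set: R] (F j)) -> (forall j x, `|F j x| <= B) ->
  integral_circle (fun x => \sum_(0 <= j < n) F j x) =
  \sum_(0 <= j < n) integral_circle (F j).
Proof.
move=> mF FB; elim: n => [|n IH].
  rewrite big_geq// -[RHS]integral_circle_cst.
  by congr integral_circle; apply/funext => x; rewrite big_geq.
rewrite big_nat_recr//= -IH -(@integral_circleD _ _ (B *+ n) B) //.
- by congr integral_circle; apply/funext => x; rewrite big_nat_recr.
- exact: measurable_sum.
- move=> x; apply: le_trans (ler_norm_sum _ _ _) _.
  rewrite -[n in B *+ n]subn0 -sumr_const_nat; apply: ler_sum => j _; exact: FB.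
Qed.

End CircleIntegral.

(** * Monotone majorants of the variation, and sums of increments over grid cells *)

Section VariationMajorant.
Variable R : realType.
Implicit Types (f T : R -> R) (V x y : R).

(* [T] stands for [x |-> total variation of f on [0, x]], extended to the line;
   unlike the variation on [[0, 1]], this notion is translation invariant. *)
Definition variation_majorant f T V :=
  [/\ periodic f 1, forall x, T (x + 1) = T x + V &
      forall x y, x <= y -> `|f y - f x| <= T y - T x].

Lemma floor_frac x : exists n : int, 0 <= x - n%:~R < 1.
Proof.
exists (Num.floor x); have /andP[h1 h2] := floor_itv x.
by rewrite subr_ge0 h1 ltrBlDr addrC -[1]/(1%:~R) -intrD.
Qed.

Lemma variation_majorant_exists f : centered_BV f ->
  exists T, variation_majorant f T (circle_variation f).
Proof.
move=> [f1 bvf _]; pose v x := fine (total_variation 0 x f).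
have v_fin x : 0 <= x <= 1 -> total_variation 0 x f \is a fin_num.
  move=> /andP[x0 x1]; apply/bounded_variationP => //.
  exact: bounded_variationl x0 x1 bvf.
have vB x y : 0 <= x -> x <= y -> y <= 1 -> `|f y - f x| <= v y - v x.
  move=> x0 xy y1; have y0 := le_trans x0 xy.
  have fx : total_variation 0 x f \is a fin_num.
    by apply: v_fin; rewrite x0 (le_trans xy).
  have fy : total_variation 0 y f \is a fin_num by apply: v_fin; rewrite y0.
  rewrite lerBrDl -lee_fin EFinD /v !fineK// (total_variationD f x0 xy).
  by rewrite leeD2l// total_variation_ge.
have v0 : v 0 = 0 by rewrite /v total_variationxx.
have V0 : 0 <= circle_variation f.
  by have := vB 0 1 (lexx _) ler01 (lexx _); rewrite v0 subr0; apply: le_trans.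
(* One full variation per completed period, plus the variation over the fractional part. *)
exists (fun x => circle_variation f * (Num.floor x)%:~R + v (x - (Num.floor x)%:~R)).
split=> // [x|x y xy].
  have -> : Num.floor (x + 1) = Num.floor x + 1.
    by rewrite floorDrz ?rpred1// floor1.
  rewrite intrD mulrDr mulr1 -addrA [_ + v _]addrC addrA; congr (_ + v _ + _).
  ring.
have /andP[nx xn] := floor_itv x; have /andP[my ym] := floor_itv y.
have nm : Num.floor x <= Num.floor y by exact: le_floor.
rewrite intrD in xn; rewrite intrD in ym.
set n := Num.floor x in nx xn nm *; set m := Num.floor y in my ym nm *.
have -> : f x = f (x - n%:~R) by rewrite -[RHS](periodic_intr f1 n) subrK.
have -> : f y = f (y - m%:~R) by rewrite -[RHS](periodic_intr f1 m) subrK.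
have [enm|neq] := eqVneq n m.
  rewrite -enm; apply: le_trans (vB _ _ _ _ _) _; [lra|lra|rewrite enm; lra|lra].
(* When an integer separates [x] from [y], the path runs from [x] to the end of its period and from
   the start of the period of [y] to [y], glued by [f 1 = f 0]; whole periods in between only
   increase [T]. *)
have {neq}nm : (n%:~R + 1 <= m%:~R :> R).
  by rewrite -[1]/(1%:~R) -intrD ler_int lezD1 lt_neqAle neq.
have h1 : `|f (y - m%:~R) - f 0| <= v (y - m%:~R) - v 0.
  by apply: vB; lra.
have h2 : `|f 1 - f (x - n%:~R)| <= v 1 - v (x - n%:~R).
  by apply: vB; lra.
have f01 : f 1 = f 0 by rewrite -[1]add0r f1.
rewrite f01 in h2; rewrite v0 subr0 in h1.
have := ler_normD (f (y - m%:~R) - f 0) (f 0 - f (x - n%:~R)).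
rewrite addrA subrK.
have : circle_variation f * (n%:~R + 1) <= circle_variation f * m%:~R.
  exact: ler_wpM2l.
rewrite mulrDr mulr1; have v1 : v 1 = circle_variation f by [].
by rewrite v1 in h2; move=> *; lra.
Qed.

Variables (f T : R -> R) (V : R).
Hypothesis fTV : variation_majorant f T V.

Lemma variation_majorant_translation x :
  variation_majorant (fun y => f (y + x)) (fun y => T (y + x)) V.
Proof.
case: fTV => f1 T1 fT; split=> [y|y|y z yz].
- by rewrite addrAC f1.
- by rewrite addrAC T1.
- by apply: fT; rewrite lerD2r.
Qed.

Lemma majorant_nondecreasing : nondecreasing_fun T.
Proof.
case: fTV => _ _ fT x y xy; rewrite -subr_ge0.
by apply: le_trans (fT _ _ xy).
Qed.

Lemma majorant_variation_ge0 : 0 <= V.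
Proof.
case: fTV => _ T1 _; have := majorant_nondecreasing ler01.
by rewrite -[1]add0r T1 lerDl.
Qed.

(** Jordan decomposition: [T] and [T - f] are both nondecreasing. *)
Lemma measurable_majorized : measurable_fun [set: R] f.
Proof.
have -> : f = T \- (T \- f) by apply/funext => x /=; rewrite subKr.
case: fTV => _ _ fT.
apply: measurable_realfun.measurable_funB;
  apply: measurable_realfun.nondecreasing_measurable => //.
  exact: majorant_nondecreasing.
move=> x y xy /=; have := le_trans (ler_norm _) (fT _ _ xy); lra.
Qed.

Lemma bounded_majorized : exists B, forall x, `|f x| <= B.
Proof.
exists (`|f 0| + V) => x; have [n /andP[n0 n1]] := floor_frac x.
case: (fTV) => f1 T1 fT.
rewrite -[x](subrK n%:~R) (periodic_intr f1) -[f _](subrKC (f 0)).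
apply: le_trans (ler_normD _ _) _; rewrite lerD2l.
apply: le_trans (fT _ _ n0) _; rewrite lerBlDl -T1 add0r.
exact/majorant_nondecreasing/ltW.
Qed.

(** Lengthening all [q] intervals by one mesh [1 / q] adds consecutive increments of [T], which
    telescope over one full period to [V]. *)
Lemma sum_majorant_increments (q n : nat) (u : R) : (0 < q)%N ->
  \sum_(0 <= r < q) (T ((r%:R + u + n%:R) / q%:R) - T ((r%:R + u) / q%:R)) = V *+ n.
Proof.
move=> q0; case: (fTV) => _ T1 _; elim: n => [|n IH].
  by rewrite big1// => r _; rewrite addr0 subrr.
have -> : V *+ n.+1 = V *+ n +
    (T ((q%:R + u + n%:R) / q%:R) - T ((0%:R + u + n%:R) / q%:R)).
  have -> : (q%:R + u + n%:R) / q%:R = (0%:R + u + n%:R) / q%:R + 1.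
    by field; rewrite pnatr_eq0 -lt0n.
  by rewrite T1 mulrSr; ring.
rewrite -IH.
rewrite -(@telescope_sumr _ 0 q (fun r => T ((r%:R + u + n%:R) / q%:R)))//.
rewrite -big_split /=; apply: eq_bigr => r _.
have -> : (r.+1%:R + u + n%:R) = r%:R + u + n.+1%:R :> R.
  by rewrite -!natr1; ring.
ring.
Qed.

(** As [p] is invertible modulo [q], the map sending [j] to [j * p + s] permutes the residues. *)
Lemma sum_arithmetic_progression (q p s : nat) (h : nat -> R) : (0 < q)%N ->
  coprime p q -> (forall r, h (r + q)%N = h r) ->
  \sum_(0 <= j < q) h (j * p + s)%N = \sum_(0 <= r < q) h r.
Proof.
case: q => // q _ cpq hq; rewrite !big_mkord.
have h_mod r : h r = h (r %% q.+1)%N.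
  rewrite {1}(divn_eq r q.+1); elim: (r %/ q.+1)%N => [//|k IH].
  by rewrite mulSn -addnA addnC hq.
pose sigma (j : 'I_q.+1) : 'I_q.+1 := inZp (j * p + s).
rewrite [RHS](reindex_inj (h := sigma)) /=; first by apply: eq_bigr => j _; exact: h_mod.
move=> i j /(congr1 val) /= /eqP; rewrite eqn_modDr.
rewrite /= => e; apply/val_inj.
wlog ij : i j e / (i <= j)%N.
  by move=> hw; case/orP: (leq_total i j) => ?; [|symmetry]; apply: hw => //;
    rewrite eq_sym.
move: e; rewrite eq_sym eqn_mod_dvd ?leq_mul2r ?ij ?orbT// -mulnBl.
rewrite Gauss_dvdl 1?coprime_sym// => /dvdn_leq le.
have jq := ltn_ord j; have [ji0|/le] := posnP (j - i)%N; rewrite /=; lia.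
Qed.

(* Each cell [(r + u) / q, (r + u + n) / q] is charged once, and the circle is
   covered n times by these cells. *)
Lemma sum_dist_cells (q p s n : nat) (u : R) (y z : nat -> R) : (0 < q)%N ->
  coprime p q ->
  (forall j, (j < q)%N ->
     (j * p + s)%:R + u <= y j * q%:R <= (j * p + s)%:R + u + n%:R) ->
  (forall j, (j < q)%N ->
     (j * p + s)%:R + u <= z j * q%:R <= (j * p + s)%:R + u + n%:R) ->
  \sum_(0 <= j < q) `|f (y j) - f (z j)| <= V *+ n.
Proof.
move=> q0 cpq hy hz; have qR : 0 < q%:R :> R by rewrite ltr0n.
rewrite -(sum_majorant_increments n u q0).
rewrite -(@sum_arithmetic_progression q p s
  (fun r => T ((r%:R + u + n%:R) / q%:R) - T ((r%:R + u) / q%:R)))//; last first.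
  move=> r; case: fTV => _ T1 _.
  have e c : ((r + q)%:R + u + c) / q%:R = (r%:R + u + c) / q%:R + 1.
    by rewrite natrD; field; exact: lt0r_neq0.
  by have := e 0; rewrite !addr0 => ->; rewrite e !T1; ring.
apply: ler_sum_nat => j /andP[_ jq].
have {hy} /andP[y1 y2] := hy j jq; have {hz} /andP[z1 z2] := hz j jq.
rewrite -ler_pdivrMr// in y1; rewrite -ler_pdivlMr// in y2.
rewrite -ler_pdivrMr// in z1; rewrite -ler_pdivlMr// in z2.
case: (fTV) => _ _ fT; have Tnd := majorant_nondecreasing.
have [zy|/ltW yz] := leP (z j) (y j); [|rewrite distrC];
  apply: le_trans (fT _ _ _) _ => //; apply: lerB; apply: Tnd => //.
Qed.

End VariationMajorant.

(** * Birkhoff sums over the rotation and a Denjoy-Koksma inequality *)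

Section BirkhoffSums.
Variables (R : realType) (alpha : R).
Implicit Types (f T : R -> R) (V x t : R).
Local Notation S f n := (birkhoff_sum alpha f n).

Lemma birkhoff_sum0 f x : S f 0 x = 0.
Proof. exact: big_geq. Qed.

Lemma birkhoff_sumS f n x : S f n.+1 x = S f n x + f (x + n%:R * alpha).
Proof. by rewrite /birkhoff_sum big_nat_recr. Qed.

Lemma birkhoff_sumD f m n x : S f (m + n) x = S f m x + S f n (x + m%:R * alpha).
Proof.
elim: n => [|n IH]; first by rewrite addn0 birkhoff_sum0 addr0.
by rewrite addnS !birkhoff_sumS IH natrD mulrDl !addrA.
Qed.

Lemma birkhoff_sum_periodic f n : periodic f 1 -> periodic (S f n) 1.
Proof. by move=> f1 x; apply: eq_bigr => j _; rewrite addrAC f1. Qed.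

Lemma measurable_birkhoff_sum f n : measurable_fun [set: R] f ->
  measurable_fun [set: R] (S f n).
Proof.
move=> mf; apply: measurable_sum => j.
exact: (measurableT_comp mf (measurable_translation (j%:R * alpha))).
Qed.

Lemma bounded_birkhoff_sum f n B : (forall x, `|f x| <= B) ->
  forall x, `|S f n x| <= B *+ n.
Proof.
move=> fB x; apply: le_trans (ler_norm_sum _ _ _) _.
by rewrite -[n in B *+ n]subn0 -sumr_const_nat; apply: ler_sum => j _.
Qed.

Lemma integral_birkhoff_sum f n B : measurable_fun [set: R] f ->
  (forall x, `|f x| <= B) -> periodic f 1 ->
  integral_circle (S f n) = integral_circle f *+ n.
Proof.
move=> mf fB f1; rewrite (@integral_circle_sum _ _ B) //; last first.
  by move=> j; exact: (measurableT_comp mf (measurable_translation (j%:R * alpha))).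
rewrite -[n in RHS]subn0 -sumr_const_nat; apply: eq_bigr => j _.
exact: integral_circle_translation fB f1.
Qed.

(** The error [|q * alpha - p|] accumulates [j < q] times and so stays below 1 on the scale where
    the grid has mesh 1. *)
Lemma rotation_cell (q p j : nat) : (j < q)%N ->
  `|q%:R * alpha - p%:R| <= q%:R^-1 ->
  (j * p)%:R - 1 <= j%:R * alpha * q%:R <= (j * p)%:R + 1.
Proof.
move=> jq h; have q0 : 0 < q%:R :> R by rewrite ltr0n (leq_ltn_trans _ jq).
rewrite -ler_distl; have -> : j%:R * alpha * q%:R - (j * p)%:R =
  j%:R * (q%:R * alpha - p%:R) :> R by rewrite natrM; ring.
rewrite normrM normr_nat; apply: le_trans (ler_wpM2l _ h) _ => //.
by rewrite ler_pdivrMr// mul1r ler_nat ltnW.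
Qed.

Section Majorized.
Variables (f T : R -> R) (V : R).
Hypothesis fTV : variation_majorant f T V.

Section Convergent.
Variables (q p : nat).
Hypotheses (q0 : (0 < q)%N) (cpq : coprime p q).
Hypothesis qp : `|q%:R * alpha - p%:R| <= q%:R^-1.

Lemma birkhoff_sum_grid x :
  `|S f q x - \sum_(0 <= r < q) f (r%:R / q%:R)| <= V *+ 3.
Proof.
have [f1 _ _] := fTV; have qR : 0 < q%:R :> R by rewrite ltr0n.
(* Nonnegativity lets the grid index [s] of [x] be a natural number. *)
wlog x0 : x / 0 <= x.
  move=> hw; have [n /andP[n0 _]] := floor_frac x.
  rewrite -[x](subrK n%:~R) (periodic_intr (birkhoff_sum_periodic _ f1)).
  exact: hw.
pose s := Num.truncn (x * q%:R).
have /andP[s1] := truncn_itv (mulr_ge0 x0 (ltW qR)).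
rewrite -/s -natr1 => s2.
rewrite -(@sum_arithmetic_progression _ q p s (fun r => f (r%:R / q%:R)))//; last first.
  by move=> r; rewrite natrD mulrDl divff ?lt0r_neq0// f1.
rewrite -sumrB; apply: le_trans (ler_norm_sum _ _ _) _.
(* After scaling by [q], [x] lies in [[s, s + 1)] and [j * alpha] within 1 of [j * p]. Orbit point
   and node thus share the cell from [j * p + s - 1] to [j * p + s + 2], of length 3. *)
apply: (@sum_dist_cells _ _ _ _ fTV q p s 3 (-1) (fun j => x + j%:R * alpha)
  (fun j => (j * p + s)%:R / q%:R)) => // j jq.
  have /andP[c1 c2] := rotation_cell jq qp.
  by rewrite mulrDl natrD; apply/andP; split; lra.
by rewrite mulfVK ?lt0r_neq0//; apply/andP; split; lra.
Qed.

(** The grid sum does not depend on [x] and [S f q] has mean 0, so averaging [birkhoff_sum_grid]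
    bounds the grid sum by [V *+ 3]; the triangle inequality doubles this. *)
Lemma denjoy_koksma x : integral_circle f = 0 -> `|S f q x| <= V *+ 6.
Proof.
move=> If; set G := \sum_(0 <= r < q) f (r%:R / q%:R).
have [f1 _ _] := fTV; have [B fB] := bounded_majorized fTV.
have mf := measurable_majorized fTV.
suff hG : `|G| <= V *+ 3.
  rewrite -[S f q x](subrK G) (le_trans (ler_normD _ _))//.
  by rewrite (mulrnDr V 3 3) lerD// birkhoff_sum_grid.
have -> : G = - integral_circle (fun x => S f q x + - G).
  rewrite (@integral_circleD _ _ _ (B *+ q) `|G|) //.
  - by rewrite (integral_birkhoff_sum _ mf fB f1) If mul0rn add0r
      integral_circle_cst opprK.
  - exact: measurable_birkhoff_sum.
  - exact: bounded_birkhoff_sum.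
  - by move=> _; rewrite normrN.
rewrite normrN; apply: le_norm_integral_circle => [|y]; last exact: birkhoff_sum_grid.
by apply: measurable_realfun.measurable_funB => //; exact: measurable_birkhoff_sum.
Qed.

Lemma sum_increments_rotation (q' p' : nat) x : (q <= q')%N ->
  `|q'%:R * alpha - p'%:R| <= q'%:R^-1 ->
  \sum_(0 <= j < q) `|f (x + j%:R * alpha + q'%:R * alpha) - f (x + j%:R * alpha)|
    <= V *+ 4.
Proof.
move=> qq' qp'; set d := q'%:R * alpha - p'%:R in qp'.
have qR : 0 < q%:R :> R by rewrite ltr0n.
have {qp'} : `|d * q%:R| <= 1.
  rewrite normrM normr_nat -ler_pdivlMr// mul1r (le_trans qp')//.
  by rewrite lef_pV2 ?posrE ?ler_nat// ltr0n (leq_trans q0).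
rewrite ler_norml => /andP[d1 d2].
have fx := variation_majorant_translation fTV x; have [f1 _ _] := fTV.
(* Periodicity replaces the shift [q' * alpha] by the small [d], and the base point [x] is absorbed
   into the function. *)
have -> : \sum_(0 <= j < q) `|f (x + j%:R * alpha + q'%:R * alpha) - f (x + j%:R * alpha)|
  = \sum_(0 <= j < q) `|f (j%:R * alpha + d + x) - f (j%:R * alpha + x)|.
  apply: eq_bigr => j _; rewrite [x + _]addrC.
  rewrite -[f (j%:R * alpha + d + x)](periodicn f1 p') /d.
  by congr (`|f _ - _|); ring.
move: d d1 d2 => d d1 d2.
(* On the scale of mesh 1, [j * alpha] is within 1 of [j * p] and [d] moves it by at most 1 more:
   cells of radius 2, length 4. *)
apply: (@sum_dist_cells _ _ _ _ fx q p 0 4 (-2) (fun j => j%:R * alpha + d)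
  (fun j => j%:R * alpha)) => // j jq;
  have /andP[c1 c2] := rotation_cell jq qp;
  by rewrite ?mulrDl addn0; apply/andP; split; lra.
Qed.

End Convergent.
End Majorized.
End BirkhoffSums.

(** * Functions varying little along orbit segments, and summation by parts *)

Section SlowlyVarying.
Variables (R : realType) (alpha : R).
Implicit Types (f g psi : R -> R) (V W D x : R).
Local Notation S f n := (birkhoff_sum alpha f n).

(** A single [W] controls both the supremum and the variation along orbit segments, which gives
    products a simple rule. *)
Definition slowly_varying (q : nat) W g :=
  [/\ measurable_fun [set: R] g, periodic g 1, forall x, `|g x| <= W &
      forall x, \sum_(0 <= j < q)
        `|g (x + j.+1%:R * alpha) - g (x + j%:R * alpha)| <= W].

(** Leibniz rule for increments: each of its two terms contributes [W * W'], whence the factor 2. *)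
Lemma slowly_varyingM q W W' g g' : slowly_varying q W g ->
  slowly_varying q W' g' ->
  slowly_varying q (2 * W * W') (fun x => g x * g' x).
Proof.
move=> [mg g1 gW vg] [mg' g1' gW' vg'].
have W0 : 0 <= W := le_trans (normr_ge0 _) (gW 0).
have W'0 : 0 <= W' := le_trans (normr_ge0 _) (gW' 0).
split=> [|x|x|x].
- exact: measurable_realfun.measurable_funM.
- by rewrite g1 g1'.
- rewrite normrM; apply: le_trans (ler_pM _ _ (gW x) (gW' x)) _ => //.
  by rewrite mulr2n !mulrDl mul1r lerDl mulr_ge0.
- apply: (@le_trans _ _ (W' * (\sum_(0 <= j < q)
      `|g (x + j.+1%:R * alpha) - g (x + j%:R * alpha)|) +
    W * (\sum_(0 <= j < q)
      `|g' (x + j.+1%:R * alpha) - g' (x + j%:R * alpha)|))).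
    rewrite !mulr_sumr -big_split /=; apply: ler_sum => j _.
    set u := x + _; set v := x + _.
    have -> : g u * g' u - g v * g' v = g' u * (g u - g v) + g v * (g' u - g' v).
      by ring.
    apply: le_trans (ler_normD _ _) _; rewrite !normrM.
    by apply: lerD; apply: ler_wpM2r.
  have h1 : W' * (\sum_(0 <= j < q)
      `|g (x + j.+1%:R * alpha) - g (x + j%:R * alpha)|) <= W' * W.
    exact: ler_wpM2l.
  have h2 : W * (\sum_(0 <= j < q)
      `|g' (x + j.+1%:R * alpha) - g' (x + j%:R * alpha)|) <= W * W'.
    exact: ler_wpM2l.
  by move: (lerD h1 h2) => /le_trans; apply; rewrite [W' * W]mulrC
    -mulr2n -mulrA mulr_natl.
Qed.

Lemma birkhoff_sum_by_parts psi g n x :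
  S (fun y => psi y * g y) n x = S psi n x * g (x + n%:R * alpha) -
  \sum_(0 <= j < n) S psi j.+1 x *
    (g (x + j.+1%:R * alpha) - g (x + j%:R * alpha)).
Proof.
elim: n => [|n IH]; first by rewrite !birkhoff_sum0 big_geq// mul0r subr0.
rewrite birkhoff_sumS IH big_nat_recr//= !birkhoff_sumS; ring.
Qed.

(* The orbit average of [psi * g] has the integral of [psi * g], and is
   uniformly small by summation by parts. *)
Lemma integral_slowly_varying psi g q D W : (0 < q)%N ->
  measurable_fun [set: R] psi -> periodic psi 1 ->
  (forall x n, (n <= q)%N -> `|S psi n x| <= D) -> slowly_varying q W g ->
  `|integral_circle (fun x => psi x * g x)| <= 2 * D * W / q%:R.
Proof.
move=> q0 mpsi psi1 psiD [mg g1 gW vg].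
have W0 : 0 <= W := le_trans (normr_ge0 _) (gW 0).
have D0 : 0 <= D := le_trans (normr_ge0 _) (psiD 0 0%N (leq0n _)).
have qR : 0 < q%:R :> R by rewrite ltr0n.
have mF : measurable_fun [set: R] (fun x => psi x * g x).
  exact: measurable_realfun.measurable_funM.
(* [D] bounds [psi] itself, as a Birkhoff sum of length 1. *)
have FB x : `|psi x * g x| <= D * W.
  rewrite normrM ler_pM//; have := psiD x 1%N q0.
  by rewrite birkhoff_sumS birkhoff_sum0 mul0r addr0 add0r.
rewrite ler_pdivlMr// -[q%:R]normr_nat -normrM mulr_natr.
rewrite -(@integral_birkhoff_sum _ alpha _ q (D * W))//; last first.
  by move=> x; rewrite psi1 g1.
apply: le_norm_integral_circle => [|x]; first exact: measurable_birkhoff_sum.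
rewrite birkhoff_sum_by_parts; apply: le_trans (ler_normB _ _) _.
have -> : 2 * D * W = D * W + D * W by ring.
apply: lerD.
  by rewrite normrM ler_pM// psiD.
apply: le_trans (ler_norm_sum _ _ _) _.
apply: le_trans (ler_wpM2l D0 (vg x)); rewrite mulr_sumr.
(* The partial sums have length [j.+1], which reaches [q]: the bound [D] has to include that
   endpoint. *)
apply: ler_sum_nat => j /andP[_ jq].
by rewrite normrM ler_wpM2r// psiD.
Qed.

End SlowlyVarying.

(** * Bounds for Birkhoff sums in terms of partial quotients *)

Section QuotientBounds.
Variables (R : realType) (alpha : R).
Hypotheses (alpha_gt0 : 0 < alpha) (alpha_lt1 : alpha < 1).
Hypothesis alpha_irr : irrational alpha.
Local Notation a := (cf_quotient alpha).
Local Notation q := (cf_denom alpha).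
Local Notation S f n := (birkhoff_sum alpha f n).

Let q_gt0 n : (0 < q n)%N.
Proof. exact: cf_denom_gt0. Qed.

Let q_coprime n : coprime (cf_numer alpha n) (q n).
Proof. exact: coprime_cf. Qed.

Let q_dist n : `|(q n)%:R * alpha - (cf_numer alpha n)%:R| <= (q n)%:R^-1.
Proof. exact: convergent_dist. Qed.

Section Majorized.
Variables (f T : R -> R) (V : R).
Hypotheses (fTV : variation_majorant f T V) (f_centered : integral_circle f = 0).

Lemma birkhoff_sum_denomM b n x : `|S f (b * q n) x| <= V *+ 6 *+ b.
Proof.
elim: b x => [|b IH] x; first by rewrite mul0n birkhoff_sum0 normr0.
rewrite mulSn birkhoff_sumD mulrS (le_trans (ler_normD _ _))// lerD//.
exact: (denjoy_koksma fTV (q_gt0 n) (q_coprime n)).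
Qed.

(* Greedy (Ostrowski) expansion of [j] in the denominators. *)
Lemma birkhoff_sum_lt_denom n j x : (j < q n)%N ->
  `|S f j x| <= V *+ 6 *+ \sum_(0 <= i < n) a i.+1.
Proof.
elim: n j x => [|n IH] j x jq.
  by move: jq; rewrite /= ltnS leqn0 => /eqP ->; rewrite birkhoff_sum0 big_geq// normr0.
rewrite big_nat_recr//= addnC mulrnDr {1}(divn_eq j (q n)) birkhoff_sumD.
apply: le_trans (ler_normD _ _) _; rewrite lerD//; last first.
  by apply: IH; rewrite ltn_mod.
apply: le_trans (birkhoff_sum_denomM _ _ _) _.
apply: ler_wpMn2l; first by rewrite mulrn_wge0// (majorant_variation_ge0 fTV).
(* The leading digit is at most [a n.+1] because [q n.+1 <= (a n.+1 + 1) * q n]. *)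
rewrite -ltnS ltn_divLR//; apply: leq_trans jq _.
case: n {IH} => [|n]; first by rewrite muln1 leqnSn.
by rewrite cf_denomSS mulSn addnC leq_add2r cf_denom_nondecreasing.
Qed.

(** At the endpoint [j = q n] a single Denjoy-Koksma block suffices, since for [n > 0] the sum of
    quotients is at least 1. *)
Lemma birkhoff_sum_le_denom n j x : (0 < n)%N -> (j <= q n)%N ->
  `|S f j x| <= V *+ 6 *+ \sum_(0 <= i < n) a i.+1.
Proof.
move=> n0; rewrite leq_eqVlt => /predU1P[->|]; last exact: birkhoff_sum_lt_denom.
have := birkhoff_sum_denomM 1 n x; rewrite mul1n => /le_trans; apply.
apply: ler_wpMn2l; first by rewrite mulrn_wge0// (majorant_variation_ge0 fTV).
by case: n n0 => // n _; rewrite big_nat_recl// addn_gt0 cf_quotient_gt0.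
Qed.

(** The sum of length [b * q m] consists of [b] blocks; each adds at most [V *+ 6] to the supremum
    and [V *+ 4] to the variation along the orbit. *)
Lemma slowly_varying_birkhoff_sum k m b : (k <= m)%N ->
  slowly_varying alpha (q k) (V *+ 6 *+ b) (S f (b * q m)).
Proof.
move=> km; have [f1 _ _] := fTV; have mf := measurable_majorized fTV.
split=> [||x|x].
- exact: measurable_birkhoff_sum.
- exact: birkhoff_sum_periodic.
- exact: birkhoff_sum_denomM.
(* One rotation step exchanges only the end terms of the sum. *)
have shift n y : S f n (y + alpha) - S f n y = f (y + n%:R * alpha) - f y.
  have := birkhoff_sumD alpha f 1 n y; rewrite add1n !birkhoff_sumS.
  rewrite birkhoff_sum0 mul0r addr0 add0r mul1r => /eqP.
  by rewrite addrC -subr_eq => /eqP <-; ring.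
elim: b => [|b IH] in x *.
  by rewrite big1// => j _; rewrite mul0n !birkhoff_sum0 subrr normr0.
rewrite mulrS addrC.
have -> : \sum_(0 <= j < q k)
      `|S f (b.+1 * q m) (x + j.+1%:R * alpha) - S f (b.+1 * q m) (x + j%:R * alpha)|
  = \sum_(0 <= j < q k) `|(S f (b * q m) (x + j.+1%:R * alpha)
        - S f (b * q m) (x + j%:R * alpha))
      + (f (x + (b * q m)%:R * alpha + j%:R * alpha + (q m)%:R * alpha)
        - f (x + (b * q m)%:R * alpha + j%:R * alpha))|.
  apply: eq_bigr => j _; rewrite -natr1 mulrDl mul1r addrA !shift.
  rewrite [x + (b * q m)%:R * alpha + _]addrAC.
  have -> : x + j%:R * alpha + (b * q m)%:R * alpha + (q m)%:R * alpha =
      x + j%:R * alpha + (b.+1 * q m)%:R * alpha.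
    by rewrite mulSn natrD; ring.
  congr `|_|; ring.
apply: (@le_trans _ _ (V *+ 6 *+ b + V *+ 4)); last first.
  by rewrite lerD2l ler_wpMn2l// (majorant_variation_ge0 fTV).
apply: le_trans (lerD (IH x) (sum_increments_rotation fTV (q_gt0 k) (q_coprime k)
  (q_dist k) (x + (b * q m)%:R * alpha) (cf_denom_nondecreasing _ _ _ km)
  (q_dist m))) => //.
by rewrite -big_split /=; apply: ler_sum => j _; exact: ler_normD.
Qed.

End Majorized.

Lemma sum_quotients_le (A p : R) k : 0 <= A -> 0 <= p ->
  (forall n : nat, (1 <= n)%N -> (a n)%:R <= A * n%:R `^ p) -> (0 < k)%N ->
  (\sum_(0 <= i < k) a i.+1)%:R <= A * k%:R `^ (p + 1).
Proof.
move=> A0 p0 ha k0; rewrite powRD; last by rewrite pnatr_eq0 -lt0n k0 implybT.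
rewrite powRr1// natr_sum mulrA mulr_natr -[X in _ *+ X](subn0 k) -sumr_const_nat.
apply: ler_sum_nat => i /andP[_ ik]; apply: le_trans (ha _ _) _ => //.
by rewrite ler_wpM2l// ge0_ler_powR ?nnegrE// ler_nat.
Qed.

End QuotientBounds.

(** * The three correlation bounds *)

Theorem proposition2p3 (R : realType) (alpha A p : R)
    (alpha_gt0 : 0 < alpha) (alpha_lt1 : alpha < 1)
    (alpha_irr : irrational alpha)
    (A_ge1 : 1 <= A) (p_ge0 : 0 <= p)
    (quotient_le : forall n : nat, (1 <= n)%N ->
       (cf_quotient alpha n)%:R <= A * n%:R `^ p) :
  let a := cf_quotient alpha in
  let q := cf_denom alpha in
  let V := @circle_variation R in
  exists C theta1 theta2 theta3 : R,
  forall psi phi : R -> R, centered_BV psi -> centered_BV phi ->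
  forall k m l : nat, (1 <= k)%N -> (k <= m)%N -> (m <= l)%N ->
  forall bk bm bl : nat,
    (bk <= a k.+1)%N -> (bm <= a m.+1)%N -> (bl <= a l.+1)%N ->
  let phik := birkhoff_sum alpha phi (bk * q k) in
  let phim := birkhoff_sum alpha phi (bm * q m) in
  let phil := birkhoff_sum alpha phi (bl * q l) in
  [/\ `|integral_circle (fun x => psi x * phik x)|
        <= C * V psi * V phi * (k%:R `^ theta1 / (q k)%:R) * bk%:R,
      `|integral_circle (fun x => psi x * phik x * phim x)|
        <= C * V psi * V phi ^+ 2 * (m%:R `^ theta2 / (q k)%:R)
           * (bk%:R * bm%:R)
    & `|integral_circle (fun x => psi x * phik x * phim x * phil x)|
        <= C * V psi * V phi ^+ 3 * (l%:R `^ theta3 / (q k)%:R)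
           * (bk%:R * bm%:R * bl%:R)].
Proof.
(* [c] hides 864, which [done] would otherwise unfold in unary. *)
have [c c864] : exists c : R, c = 864 by exists 864.
have c0 : 0 <= c by rewrite c864 ler0n.
(* Here 12 is the 2 of summation by parts times the 6 of Denjoy-Koksma for [psi], and 864 is
   [2 ^ 2 * 6 ^ 3]: three factors of size 6 and two applications of the product rule. The exponent
   [p + 1] comes from the sum of the first [k] quotients. *)
move=> a q V; exists (12 * A * c), (p + 1), (p + 1), (p + 1).
move=> psi phi psiBV phiBV k m l k0 km ml bk bm bl _ _ _ phik phim phil.
have [Tpsi psiTV] := variation_majorant_exists psiBV.
have [Tphi phiTV] := variation_majorant_exists phiBV.
have [psi1 _ psi_int] := psiBV; have [_ _ phi_int] := phiBV.
rewrite -/(V psi) in psiTV; rewrite -/(V phi) in phiTV.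
have A0 : 0 <= A by apply: le_trans A_ge1.
have Vpsi0 := majorant_variation_ge0 psiTV.
have Vphi0 := majorant_variation_ge0 phiTV.
have slow n b : (k <= n)%N -> slowly_varying alpha (q k) (6 * (V phi * b%:R))
    (birkhoff_sum alpha phi (b * q n)).
  have -> : 6 * (V phi * b%:R) = V phi *+ 6 *+ b.
    by rewrite mulrA mulr_natr mulr_natl.
  exact: (slowly_varying_birkhoff_sum alpha_gt0 alpha_lt1 alpha_irr phiTV phi_int).
set K := k%:R `^ (p + 1).
have psiD x n : (n <= q k)%N ->
    `|birkhoff_sum alpha psi n x| <= V psi * 6 * (A * K).
  move=> nk; apply: le_trans
    (birkhoff_sum_le_denom alpha_gt0 alpha_lt1 alpha_irr psiTV psi_int x k0 nk) _.
  rewrite -[leLHS]mulr_natr -[V psi *+ 6]mulr_natr ler_wpM2l ?mulr_ge0//.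
  exact: sum_quotients_le.
have qR : 0 < (q k)%:R :> R by rewrite ltr0n cf_denom_gt0.
have K0 : 0 <= K by exact: powR_ge0.
have mono n : (k <= n)%N -> K <= n%:R `^ (p + 1).
  by move=> kn; rewrite ge0_ler_powR ?nnegrE ?addr_ge0// ler_nat.
(* Common form of the three bounds: [g] is the product of ergodic sums, [B] its monomial in [V phi]
   and the digits, and [n] the largest index, to which the power of [k] is relaxed. *)
have main g W B n : (k <= n)%N -> slowly_varying alpha (q k) W g ->
    0 <= B -> W <= c * B ->
    `|integral_circle (fun x => psi x * g x)| <=
      12 * A * c * V psi * B * (n%:R `^ (p + 1) / (q k)%:R).
  move=> kn gW B0 WB.
  apply: le_trans (integral_slowly_varying (cf_denom_gt0 _ _ _ k)
    (measurable_majorized psiTV) psi1 psiD gW) _ => //.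
  rewrite [leRHS]mulrA; apply: ler_wpM2r; first by rewrite invr_ge0 ltW.
  apply: (@le_trans _ _ (12 * A * V psi * (c * B) * K)).
    have -> : 2 * (V psi * 6 * (A * K)) * W = 12 * A * V psi * K * W by ring.
    have -> : 12 * A * V psi * (c * B) * K = 12 * A * V psi * K * (c * B) by ring.
    by rewrite ler_wpM2l// !mulr_ge0.
  have -> : 12 * A * V psi * (c * B) * K = 12 * A * c * V psi * B * K by ring.
  by rewrite ler_wpM2l ?mono// !mulr_ge0.
have sk := slow k bk (leqnn k); have sm := slow m bm km.
have sl := slow l bl (leq_trans km ml).
have skm := slowly_varyingM sk sm; have skml := slowly_varyingM skm sl.
have B1 : 0 <= V phi * bk%:R by rewrite mulr_ge0.
have B2 : 0 <= V phi ^+ 2 * (bk%:R * bm%:R) by rewrite mulr_ge0 ?exprn_ge0.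
have B3 : 0 <= V phi ^+ 3 * (bk%:R * bm%:R * bl%:R).
  by rewrite mulr_ge0 ?exprn_ge0 ?mulr_ge0.
split.
- have -> : 12 * A * c * V psi * V phi * (K / (q k)%:R) * bk%:R =
    12 * A * c * V psi * (V phi * bk%:R) * (K / (q k)%:R) by ring.
  apply: main sk _ _ => //.
  by rewrite ler_wpM2r// c864; lra.
- have -> : 12 * A * c * V psi * V phi ^+ 2 *
      (m%:R `^ (p + 1) / (q k)%:R) * (bk%:R * bm%:R) =
    12 * A * c * V psi * (V phi ^+ 2 * (bk%:R * bm%:R)) *
      (m%:R `^ (p + 1) / (q k)%:R).
    by ring.
  under [X in integral_circle X]funext do rewrite -mulrA.
  apply: main skm _ _ => //.
  have -> : 2 * (6 * (V phi * bk%:R)) * (6 * (V phi * bm%:R)) =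
    72 * (V phi ^+ 2 * (bk%:R * bm%:R)) by ring.
  by rewrite ler_wpM2r// c864; lra.
- have -> : 12 * A * c * V psi * V phi ^+ 3 *
      (l%:R `^ (p + 1) / (q k)%:R) * (bk%:R * bm%:R * bl%:R) =
    12 * A * c * V psi * (V phi ^+ 3 * (bk%:R * bm%:R * bl%:R)) *
      (l%:R `^ (p + 1) / (q k)%:R).
    by ring.
  under [X in integral_circle X]funext do rewrite -2!mulrA [_ * (phim _ * _)]mulrA.
  apply: main skml _ _ => //; first exact: leq_trans ml.
  have -> : 2 * (2 * (6 * (V phi * bk%:R)) * (6 * (V phi * bm%:R))) *
    (6 * (V phi * bl%:R)) = c * (V phi ^+ 3 * (bk%:R * bm%:R * bl%:R)).
    by rewrite c864; ring.
  exact: lexx.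
Qed.
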